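(* Let $S$ be a finite semigroup, let $\mathcal A(S)=(S,Q(S),\iota,\cdot)$ be the automaton defined in the context (for any choice of the idempotents $E_X$ and of the permutations $g_{(s,R)}$), and let $\Phi=\mathrm{val}:Q(S)\setminus\{\iota\}\to\mathcal P(S)$, $(X,d,g)\mapsto\bigcup([X]_{\mathrm{II}}\odot d^{-1}g)$. Then $\Phi$ is a flow, that is, $s\in(\iota\cdot s)\Phi$ and $(q)\Phi\cdot\{s\}\subseteq(q\cdot s)\Phi$ for all $s\in S$ and all $q\in Q(S)\setminus\{\iota\}$. Consequently $(S,\mathcal A(S),\Phi)$ is a flow automaton, and its cover complex satisfies $\mathrm{Cov}(S,\mathcal A(S),\Phi)\subseteq\mathsf C_{\mathbf{ER}}(S)$.
   Context: A flow automaton is a triple $(S,\mathcal A,\Phi)$ where $S$ is a finite semigroup, $\mathcal A=(S,Q,\iota,\cdot)$ is an automaton with input symbols $S$, finite state set $Q$, initial state $\iota\in Q$ and transition function $Q\times S\to Q$, and $\Phi:Q\setminus\{\iota\}\to\mathcal P(S)$ is a function (a flow) with $s\in(\iota\cdot s)\Phi$ and $(q)\Phi\cdot\{s\}\subseteq(q\cdot s)\Phi$ for all $s\in S$, $q\in Q\setminus\{\iota\}$. Its cover complex is $\mathrm{Cov}(S,\mathcal A,\Phi)=\{X\in\mathcal P(S): X\subseteq(q)\Phi\text{ for some }q\in Q\setminus\{\iota\}\}$. Maps are written on the right. For a finite semigroup $T$: $T^I$ is $T$ with a new identity element $I$ adjoined; $E(T)$ is the set of idempotents; $x^\omega$ is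 the unique idempotent power of $x$; $x\le_{\mathcal R}y$ iff $x\in yT^I$, $<_{\mathcal R}$ is its strict version, and $\mathcal R$ the induced equivalence, with $R_x$ the $\mathcal R$-class of $x$; $J_x$ is the $\mathcal J$-class of $x$. $K_{\mathbf G}(T)$ (group kernel) is the set of $x\in T$ such that $(x,1_G)\in\rho$ for every finite group $G$ and every subsemigroup $\rho\subseteq T\times G$ projecting onto $T$. Type-II partition on $T$: $x\equiv_{\mathrm{II}}y$ iff $xa=y$, $yb=x$ for some $a,b\in K_{\mathbf G}(T)^I$; $[x]_{\mathrm{II}}$ is the class of $x$. It is contained in $\mathcal R$. For an $\mathcal R$-class $R$, $R/\mathrm{II}$ is the set of type-II classes in $R$, on which $T$ acts by partial injections: $[x]_{\mathrm{II}}\ast s=[x's]_{\mathrm{II}}$ if some $x'\equiv_{\mathrm{II}}x$ has $x's\in R$, and undefined otherwise (this is well defined). Right activator: for a $\mathcal J$-class $J$ of $T$, $\mathrm{RAct}(J)$ is the unique $\le_{\mathcal J}$-minimal $\mathcal J$-class of $T^I$ contained in $\{a\in T^I: Ja\cap J\ne\varnothing\}$. For $x\in T$, $\mathcal F_x$ is the set of $t\in\mathrm{RAct}(J_x)$ such that (1) $xt=x$; (2) for all $s\in T$, $xs<_{\mathcal R}x$ iff $ts<_{\mathcal R}t$; (3) left multiplication by $x$ maps $R_t$ onto $R_x$. $\mathcal F_x$ always contains an idempotent. Let $S$ be a finite semigroup. $\mathcal P(S)$ is the semigroup of non-empty subsets of $S$ under setwise product. An $S$-complex is a subsemigroup of $\mathcal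 P(S)$ containing all singletons and closed under non-empty subsets of members. $C=\mathsf C_{\mathbf{ER}}(S)$ is the intersection of all $S$-complexes $\mathcal K$ such that $\bigcup[E]_{\mathrm{II}}\in\mathcal K$ for every idempotent $E$ of the semigroup $\mathcal K$, with $[E]_{\mathrm{II}}$ computed in $\mathcal K$; it is itself the smallest such complex. For $X\in C$, $(X)\beta=\bigcup[X]_{\mathrm{II}}$ (class computed in the semigroup $C$), which lies in $C$; also $(I)\beta=I$. For each $X\in C$ choose an idempotent $E_X\in\mathcal F_X$ (computed in $C$), with $E_F=F$ if $F$ is idempotent, and put $(X)\psi=X\cdot((E_X)\beta)^\omega$. Let $\overline X=(X)\psi^\omega$, where $\psi^\omega$ is the idempotent power of the self-map $\psi$ of $C$. Let $\mathbb F=\{X\in C:(X)\psi=X\}$ and $\mathbb B=\{[X]_{\mathrm{II}}:X\in\mathbb F\}=\{\pi\in C/\mathrm{II}:\bigcup\pi\in\pi\}$. Groups: for each $\mathcal R$-class $R$ of $C$ and $s\in S$, choose a permutation $g_{(s,R)}$ of $R/\mathrm{II}$ extending the partial injection $[X]_{\mathrm{II}}\mapsto[X]_{\mathrm{II}}\ast\{s\}$. Let $\mathscr R=\{R_X:X\in\mathbb F\}$, $g_s=(g_{(s,R)})_{R\in\mathscr R}$, and let $\mathbb G$ be the (finite) group generated by $\{g_s : s\in S\}$ in the product over $R\in\mathscr R$ of the symmetric groups on $R/\mathrm{II}$. $\mathbb G$ acts on the right on $\bigcup_{R\in\mathscr R}R/\mathrm{II}$ componentwise, written $[X]_{\mathrm{II}}\odot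 g$. Automaton: $Q(S)=\{(X,d,g)\in\mathbb F\times\mathbb G\times\mathbb G:[X]_{\mathrm{II}}\odot d^{-1}g\in\mathbb B\}\cup\{\iota\}$ with initial state $\iota$. For $(X,d,g)\in Q(S)\setminus\{\iota\}$, set $\mathrm{val}(X,d,g)=\bigcup([X]_{\mathrm{II}}\odot d^{-1}g)\in\mathbb F$. For $s\in S$ define $\lambda_s:Q(S)\setminus\{\iota\}\to\mathbb F\times\mathbb G$ by $(X,d,g)\lambda_s=(X,d)$ if $\mathrm{val}(X,d,g)\cdot\{s\}\ \mathcal R\ \mathrm{val}(X,d,g)$ in $C$ and $(X,d,gg_s)\in Q(S)$, and $(X,d,g)\lambda_s=(\overline{\mathrm{val}(X,d,g)\cdot\{s\}},\,gg_s)$ otherwise. The transitions are $\iota\cdot s=(\overline{\{s\}},g_s,g_s)$ and $(X,d,g)\cdot s=((X,d,g)\lambda_s,\,gg_s)$, which always lie in $Q(S)\setminus\{\iota\}$. *)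

(* Defs.v *)
From HB Require Import structures.
From mathcomp Require Import all_boot all_fingroup.
From mathcomp Require Import boolp.

Set Implicit Arguments.
Unset Strict Implicit.
Unset Printing Implicit Defensive.

Local Open Scope group_scope.

(* HB rejects a join of [finType] and [semigroupType] declared after fingroup
   (missing join with [finStarMonoidType]); hence a separate structure. *)
HB.mixin Record Finite_isSemigroup T of Finite T := {
  smul : T -> T -> T;
  smulA : associative smul
}.

#[short(type="finSemigroupType")]
HB.structure Definition FinSemigroup := {T of Finite T & Finite_isSemigroup T}.

Infix "**" := smul (at level 40, left associativity) : group_scope.

Section IdempotentPower.
Variable T : finSemigroupType.
Implicit Types x : T.

Definition idem x := x ** x == x.

(* x to the power n + 1 *)
Definition pow1 x n : T := iter n (smul x) x.

Lemma pow1D x m n : pow1 x m ** pow1 x n = pow1 x (m + n).+1.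
Proof. by elim: m => // m IHm; rewrite /= -smulA -/(pow1 x m) IHm. Qed.

Lemma ex_idem_pow1 x : exists n, idem (pow1 x n).
Proof.
have [i [j [ltij eqij]]] : exists i j, i < j /\ pow1 x i = pow1 x j.
  pose f (k : 'I_#|T|.+1) := pow1 x k.
  have /injectivePn[k [l neq_kl eq_kl]] : ~~ injectiveb f.
    by apply/injectiveP => /leq_card; rewrite card_ord ltnn.
  have [ltkl|ltlk|/ord_inj eqkl] := ltngtP k l.
  - by exists k, l.
  - by exists l, k.
  - by rewrite eqkl eqxx in neq_kl.
pose p := (j - i)%N.
have p_gt0 : 0 < p by rewrite subn_gt0.
have shift1 m : i <= m -> pow1 x (m + p) = pow1 x m.
  move=> /subnK <-; case: (m - i)%N => [|d]; first by rewrite add0n subnKC // ltnW.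
  by rewrite -addnA subnKC ?(ltnW ltij) // !addSn -!pow1D eqij.
have shift k m : i <= m -> pow1 x (m + k * p) = pow1 x m.
  move=> le_im; elim: k => [|k IHk]; first by rewrite mul0n addn0.
  by rewrite mulSn (addnC p) addnA shift1 // (leq_trans le_im) // leq_addr.
exists (i.+1 * p).-1; set m := (i.+1 * p).-1.
have mE : m.+1 = (i.+1 * p)%N by rewrite prednK // muln_gt0.
apply/eqP; rewrite pow1D -addnS mE shift //.
by rewrite -ltnS mE leq_pmulr.
Qed.

Definition omega x : T := pow1 x (ex_minn (ex_idem_pow1 x)).

Lemma idem_omega x : idem (omega x).
Proof. by rewrite /omega; case: ex_minnP. Qed.

End IdempotentPower.

(* Self-maps of a finite set, written on the right: x(fg) = (xf)g. *)
Section SelfMap.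
Variable T : finType.
Definition ffun_smul (f g : {ffun T -> T}) : {ffun T -> T} := [ffun x => g (f x)].
Lemma ffun_smulA : associative ffun_smul.
Proof. by move=> f g h; apply/ffunP => x; rewrite !ffunE. Qed.
HB.instance Definition _ := Finite_isSemigroup.Build {ffun T -> T} ffun_smulA.
End SelfMap.

(* [option T] is the semigroup T^I, with I = None. *)
Section AdjoinIdentity.
Variable T : finSemigroupType.
Definition option_smul (x y : option T) : option T :=
  match x, y with
  | Some a, Some b => Some (a ** b)
  | None, _ => y
  | _, None => x
  end.
Lemma option_smulA : associative option_smul.
Proof. by move=> [x|] [y|] [z|] //=; rewrite smulA. Qed.
HB.instance Definition _ := Finite_isSemigroup.Build (option T) option_smulA.
End AdjoinIdentity.

(* All subsets of S, including set0; P(S) is the subsemigroup [nePow S]. *)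
Section PowerSemigroup.
Variable S : finSemigroupType.
Definition set_smul (X Y : {set S}) : {set S} := [set x ** y | x in X, y in Y].
Lemma set_smulA : associative set_smul.
Proof.
move=> X Y Z; apply/setP=> u; apply/imset2P/imset2P.
- case=> x v xX /imset2P[y z yY zZ ->] ->; exists (x ** y) z => //.
    by apply/imset2P; exists x y.
  by rewrite smulA.
- case=> v z /imset2P[x y xX yY ->] zZ ->; exists x (y ** z) => //.
    by apply/imset2P; exists y z.
  by rewrite smulA.
Qed.
HB.instance Definition _ := Finite_isSemigroup.Build {set S} set_smulA.
Definition nePow : {set {set S}} := [set X | X != set0].
End PowerSemigroup.

Arguments nePow S : clear implicits.

(* Green's relations, the group kernel, etc. of a subsemigroup A of T, computed
   in A (not in T). *)
Section Green.
Variables (T : finSemigroupType) (A : {set T}).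
Implicit Types (x y : T) (a b : option T).

(* A^I *)
Definition adjI : {set option T} := None |: [set Some x | x in A].

(* the product x a, with x in T and a in T^I *)
Definition mulI x a : T := if a is Some y then x ** y else x.

Definition leR x y := [exists a in adjI, x == mulI y a].
Definition ltR x y := leR x y && ~~ leR y x.
Definition eqR x y := leR x y && leR y x.
Definition Rclass x := [set y in A | eqR x y].

Definition leJ x y :=
  [exists a in adjI, exists b in adjI, Some x == a ** Some y ** b].
Definition eqJ x y := leJ x y && leJ y x.
Definition Jclass x := [set y in A | eqJ x y].

(* rho is a subsemigroup of A x gT projecting onto A *)
Definition onto_subsemigroup (gT : finGroupType) (rho : {set T * gT}) :=
  [set p.1 | p in rho] = A /\
  {in rho &, forall p q, (p.1 ** q.1, p.2 * q.2) \in rho}.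

Definition group_kernel : {set T} :=
  [set x in A | `[< forall (gT : finGroupType) (rho : {set T * gT}),
                     onto_subsemigroup rho -> (x, 1) \in rho >] ].

End Green.

Section TypeII.
Variables (T : finSemigroupType) (A : {set T}).
Implicit Types (x y s : T) (R J pi : {set T}).

Definition eqII x y :=
  [exists a in adjI (group_kernel A), mulI x a == y] &&
  [exists b in adjI (group_kernel A), mulI y b == x].
Definition classII x := [set y in A | eqII x y].

Definition quoII R := [set classII x | x in R].

(* the graph of the partial map pi |-> pi * s on R/II *)
Definition actII R s pi (pi' : {set T}) :=
  exists2 x, x \in pi & x ** s \in R /\ pi' = classII (x ** s).

Definition activators J : {set option T} :=
  [set a in adjI A | [exists x in J, mulI x a \in J]].

(* The union of the <=_J-minimal J-classes of A^I contained in [activators J];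
   there is exactly one such J-class. *)
Definition RAct J : {set option T} :=
  let AI := adjI A in
  [set a in AI | (Jclass AI a \subset activators J) &&
     [forall b in AI,
        (Jclass AI b \subset activators J) && leJ AI b a ==> leJ AI a b]].

(* Here <_R and R_t, for t in T^I, are computed in the semigroup A^I. *)
Definition calF x : {set option T} :=
  let AI := adjI A in
  [set t in RAct (Jclass A x) |
    [&& mulI x t == x,
        [forall s in A, ltR A (x ** s) x == ltR AI (t ** Some s) t]
      & [set mulI x u | u in Rclass AI t] == Rclass A x]].

End TypeII.

Section Complex.
Variable S : finSemigroupType.
Implicit Types K : {set {set S}}.

Definition is_complex K :=
  [&& K \subset nePow S,
      [forall s, [set s] \in K],
      [forall X in K, forall Y in K, X ** Y \in K]
    & [forall X in K, forall Y in nePow S, (Y \subset X) ==> (Y \in K)]].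

Definition is_ER_complex K :=
  is_complex K && [forall E in K, idem E ==> (cover (classII K E) \in K)].

Definition CER : {set {set S}} := \bigcap_(K | is_ER_complex K) K.

End Complex.

Arguments CER S : clear implicits.

Section FlowAutomaton.
Variables (S : finSemigroupType) (St : finType).
(* The state set is Q; St is only an ambient type. *)
Variables (Q : {set St}) (iota : St) (step : St -> S -> St).
Variable Phi : St -> {set S}.

Definition is_automaton :=
  iota \in Q /\ (forall q s, q \in Q -> step q s \in Q).

(* Phi stands for a map Q \ {iota} -> P(S). The flow conditions evaluate Phi at
   the states q.s, so these must differ from iota. *)
Definition is_flow :=
  [/\ forall q, q \in Q :\ iota -> Phi q \in nePow S,
      forall q s, q \in Q -> step q s \in Q :\ iota,
      forall s, s \in Phi (step iota s)
    & forall q s, q \in Q :\ iota -> Phi q ** [set s] \subset Phi (step q s)].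

Definition is_flow_automaton := is_automaton /\ is_flow.

Definition Cov : {set {set S}} :=
  [set X in nePow S | [exists q in Q :\ iota, X \subset Phi q]].

End FlowAutomaton.

Section Construction.
Variable S : finSemigroupType.
Local Notation C := (CER S).

Definition beta (X : {set S}) : {set S} := cover (classII C X).

(* E X is the idempotent E_X of C^I; values outside C are irrelevant. *)
Definition idempotent_choice (E : {set S} -> option {set S}) :=
  {in C, forall X, [/\ E X \in calF C X, idem (E X) & idem X -> E X = Some X]}.

(* g s R is the permutation g_(s,R) of R/II, for R an R-class of C. *)
Definition permutation_choice
    (g : S -> {set {set S}} -> {perm {set {set S}}}) :=
  forall s R, R \in [set Rclass C X | X in C] ->
    g s R \in Sym (quoII C R) /\
    {in quoII C R, forall pi pi', actII C R [set s] pi pi' -> g s R pi = pi'}.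

Variables (E : {set S} -> option {set S}).
Variables (g : S -> {set {set S}} -> {perm {set {set S}}}).

Definition psi (X : {set S}) : {set S} := mulI X (omega (omap beta (E X))).

(* Since psi maps C to C, the idempotent power of psi as a self-map of {set S}
   restricts to that of psi as a self-map of C. *)
Definition bar (X : {set S}) : {set S} := omega [ffun Y => psi Y] X.

Definition FF : {set {set S}} := [set X in C | psi X == X].
Definition BB : {set {set {set S}}} := [set classII C X | X in FF].
Definition scrR : {set {set {set S}}} := [set Rclass C X | X in FF].

(* Contains the product over R in scrR of the symmetric groups on R/II, as those
   are the subgroups [Sym (quoII C R)]. *)
Definition prodG : finGroupType :=
  {dffun forall _ : {R | R \in scrR}, {perm {set {set S}}}}.

Definition gen (s : S) : prodG := [ffun R => g s (val R)].
Definition GG : {set prodG} := <<[set gen s | s : S]>>.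

(* The classes of II contained in distinct R-classes are distinct, so at most one
   R is picked; the default value is not used. *)
Definition odot (pi : {set {set S}}) (h : prodG) : {set {set S}} :=
  if [pick R : {R | R \in scrR} | pi \in quoII C (val R)] is Some R
  then h R pi else pi.

Definition state : finType := option ({set S} * prodG * prodG).

Definition iotaS : state := None.

Definition in_QS (X : {set S}) (d h : prodG) :=
  [&& X \in FF, d \in GG, h \in GG & odot (classII C X) (d^-1 * h) \in BB].

Definition QS : {set state} :=
  [set q : state | if q is Some (X, d, h) then in_QS X d h else true].

Definition value (X : {set S}) (d h : prodG) : {set S} :=
  cover (odot (classII C X) (d^-1 * h)).

Definition lambda (X : {set S}) (d h : prodG) (s : S) : {set S} * prodG :=
  if eqR C (value X d h ** [set s]) (value X d h) && in_QS X d (h * gen s)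
  then (X, d)
  else (bar (value X d h ** [set s]), h * gen s).

Definition stepS (q : state) (s : S) : state :=
  if q is Some (X, d, h) then Some (lambda X d h s, h * gen s)
  else Some (bar [set s], gen s, gen s).

(* the value at the initial state is not used *)
Definition PhiS (q : state) : {set S} :=
  if q is Some (X, d, h) then value X d h else set0.

End Construction.

Arguments QS {S} E g.
Arguments iotaS {S} E.
Arguments stepS {S} E g q s.
Arguments PhiS {S} E q.

(* Main.v *)
Require Import Defs.
From mathcomp Require Import all_boot all_fingroup.
From mathcomp Require Import boolp.

Set Implicit Arguments.
Unset Strict Implicit.
Unset Printing Implicit Defensive.

Local Open Scope group_scope.

(** The map [psi] is extensive on [C], so its idempotent power sends every
element of [C] to a fixed point of [psi] containing it.  The point is that a
fixed point [X] equals the union of its type-II class: right multiplication by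
a group kernel element [a] with [X a R X] is, by the defining property of
[E_X], multiplication by [E_X a], which is R-equivalent, hence type-II
equivalent, to [E_X]; thus [X a] is contained in [X * beta E_X = X].
Consequently the value [V] of a state is a fixed point, and the next state has
as value either the union of the class of [V s] (when the pair [(X, d)] is
kept) or [bar (V s)]; both contain [V s]. *)

(** * Powers in a finite semigroup *)

Section Powers.
Variable T : finSemigroupType.
Implicit Types (x c : T).

Lemma pow1_closed (A : {set T}) x n :
  {in A &, forall y z, y ** z \in A} -> x \in A -> pow1 x n \in A.
Proof. by move=> mA xA; elim: n => //= n IHn; apply: mA. Qed.

(** With e = n + 1, [pow1 c n] is c^e. Its idempotency yields c^(2e+m) = c^(e+m) for every m, and 2e
    - 1, the exponent of [pow1 c (n + n)], is at least e. *)
Lemma pow1_periodic c n k : idem (pow1 c n) ->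
  pow1 c (n + n + k * n.+1) = pow1 c (n + n).
Proof.
move=> /eqP; rewrite pow1D => idc; elim: k => [|k IHk]; first by rewrite addn0.
rewrite mulSn (addnC n.+1) addnA.
have E m : pow1 c (n + n + m).+1 = pow1 c (n + m).
  case: m => [|m]; first by rewrite !addn0.
  by rewrite addnS -addSn -pow1D idc pow1D addnS.
by rewrite addnS -addnA [(k * _ + n)%N]addnC E addnA IHk.
Qed.

Lemma pow1_Some x n : pow1 (Some x : option T) n = Some (pow1 x n).
Proof. by elim: n => //= n ->. Qed.

Lemma pow1_None n : pow1 (None : option T) n = None.
Proof. by elim: n => //= n ->. Qed.

End Powers.

(** * The semigroup with an adjoined identity *)

Section AdjoinedIdentity.
Variable T : finSemigroupType.

Lemma mulIA x (a b : option T) : mulI (mulI x a) b = mulI x (a ** b).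
Proof. by case: a b => [a|] [b|] //=; rewrite smulA. Qed.

Lemma mem_adjI_Some (B : {set T}) x : (Some x \in adjI B) = (x \in B).
Proof.
rewrite !inE /=; apply/imsetP/idP => [[y yB [->]] //|xB]; by exists x.
Qed.

Lemma mem_adjI_None (B : {set T}) : None \in adjI B.
Proof. by rewrite !inE. Qed.

Lemma adjI_closed (B : {set T}) :
  {in B &, forall y z, y ** z \in B} ->
  {in adjI B &, forall a b, a ** b \in adjI B}.
Proof.
by move=> mB [a|] [b|] //; rewrite !mem_adjI_Some; apply: mB.
Qed.

End AdjoinedIdentity.

(** * Green's relation R and type-II classes in a subsemigroup *)

Section TypeIIClasses.
Variables (T : finSemigroupType) (A : {set T}).
Hypothesis mulA : {in A &, forall y z, y ** z \in A}.
Implicit Types x y z : T.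
Local Notation KG := (group_kernel A).

Lemma group_kernel_sub x : x \in KG -> x \in A.
Proof. by rewrite inE => /andP[]. Qed.

Lemma adjI_group_kernel_sub a : a \in adjI KG -> a \in adjI A.
Proof.
by case: a => [a|]; rewrite ?mem_adjI_None ?mem_adjI_Some //; apply: group_kernel_sub.
Qed.

(* With [e := n.+1] an exponent of an idempotent power of [a b], the witness is
   [b (a b)^(2e-1)], which equals [b (a b)^(ke-1)] for every [k >= 2].  If [b] is
   related to [h], the latter is related to [h^(ke)], so take [k := 2 #[h]]. *)
Lemma group_kernel_weak_inverse a b : a \in KG -> b \in A ->
  exists2 b', b' \in KG & forall x, x ** a ** b = x -> x ** a ** b' = x.
Proof.
move=> aK bA; have aA := group_kernel_sub aK.
have [n idn] := ex_idem_pow1 (a ** b).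
exists (b ** pow1 (a ** b) (n + n)); last first.
  move=> x xab; rewrite smulA xab; elim: (n + n)%N => [|m IHm] /=.
    by rewrite smulA.
  by rewrite !smulA xab.
rewrite inE mulA ?(pow1_closed _ mulA) ?mulA //=; apply/asboolP => gT rho hrho.
have a1 : (a, 1) \in rho.
  by move: aK; rewrite inE => /andP[_ /asboolP /(_ _ _ hrho)].
have [[b0 h] bh /= b0E] : exists2 p, p \in rho & b = p.1.
  by apply/imsetP; rewrite hrho.1.
rewrite -{}b0E in bh.
have abh : (a ** b, h) \in rho by have := hrho.2 _ _ a1 bh; rewrite /= mul1g.
have powh m : (pow1 (a ** b) m, h ^+ m.+1) \in rho.
  by elim: m => //= m IHm; rewrite expgS; apply: (hrho.2 _ _ abh IHm).
set k := (2 * #[h]).-2.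
have kE : k.+2 = (2 * #[h])%N.
  have : 0 < #[h] by rewrite order_gt0.
  by rewrite /k; case: #[h] => // m _; rewrite mulnS.
have := hrho.2 _ _ bh (powh (n + n + k * n.+1)%N); rewrite /= pow1_periodic //.
rewrite -expgS (_ : (_).+2 = k.+2 * n.+1)%N; last first.
  by rewrite !mulSn !addSn !addnS addnA.
by rewrite kE mulnAC [(_ * #[h])%N]mulnC expgM expg_order expg1n.
Qed.

Lemma leR_refl x : leR A x x.
Proof. by apply/existsP; exists None; rewrite mem_adjI_None /=. Qed.

Lemma leR_trans y x z : leR A x y -> leR A y z -> leR A x z.
Proof.
case/existsP=> a /andP[aA /eqP->] /existsP[b /andP[bA /eqP->]].
by apply/existsP; exists (b ** a); rewrite mulIA adjI_closed /=.
Qed.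

Lemma eqR_refl x : eqR A x x.
Proof. by rewrite /eqR leR_refl. Qed.

Lemma eqR_sym x y : eqR A x y = eqR A y x.
Proof. by rewrite /eqR andbC. Qed.

Lemma mem_Rclass x : x \in A -> x \in Rclass A x.
Proof. by move=> xA; rewrite inE xA eqR_refl. Qed.

Lemma eqR_trans y x z : eqR A x y -> eqR A y z -> eqR A x z.
Proof.
by move=> /andP[xy yx] /andP[yz zy]; rewrite /eqR (leR_trans xy) ?(leR_trans zy).
Qed.

Lemma Rclass_eq x y : eqR A x y -> Rclass A x = Rclass A y.
Proof.
move=> xy; apply/setP=> z; rewrite !inE; case: (z \in A) => //=.
by apply/idP/idP; apply: eqR_trans; rewrite // eqR_sym.
Qed.

Lemma eqII_refl x : eqII A x x.
Proof.
by apply/andP; split; apply/existsP; exists None; rewrite mem_adjI_None /=.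
Qed.

Lemma mem_classII x : x \in A -> x \in classII A x.
Proof. by move=> xA; rewrite inE xA eqII_refl. Qed.

Lemma eqII_eqR x y : eqII A x y -> eqR A x y.
Proof.
case/andP=> /existsP[a /andP[aK /eqP xy]] /existsP[b /andP[bK /eqP yx]].
apply/andP; split; apply/existsP.
  by exists b; rewrite (adjI_group_kernel_sub bK) yx /=.
by exists a; rewrite (adjI_group_kernel_sub aK) xy /=.
Qed.

(** The multiplier leading from [x ** a] back to [x] lies only in [A], but
    [group_kernel_weak_inverse] replaces it by one in the group kernel. *)
Lemma leR_mul_eqII x a : a \in KG -> leR A x (x ** a) -> eqII A x (x ** a).
Proof.
move=> aK /existsP[b /andP[bA /eqP xab]]; apply/andP; split; apply/existsP.
  by exists (Some a); rewrite mem_adjI_Some aK /=.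
case: b => [b|] /= in bA xab; last first.
  by exists None; rewrite mem_adjI_None /= -xab.
have [|b' b'K /(_ x) h] := group_kernel_weak_inverse aK (b := b).
  by rewrite mem_adjI_Some in bA.
by exists (Some b'); rewrite mem_adjI_Some b'K /= h.
Qed.

(** Type-II equivalence refines R, so a type-II class determines the R-class around it. This pins
    down the component that [odot] picks. *)
Lemma quoII_Rclass_inj x y pi :
  pi \in quoII A (Rclass A x) -> pi \in quoII A (Rclass A y) ->
  Rclass A x = Rclass A y.
Proof.
move=> /imsetP[u ux ->] /imsetP[v vy uv].
move: ux vy; rewrite !inE => /andP[uA xu] /andP[vA yv].
have : u \in classII A v by rewrite -uv mem_classII.
rewrite inE uA /= => /eqII_eqR vu.
by rewrite (Rclass_eq xu) (Rclass_eq yv) (Rclass_eq vu).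
Qed.

Lemma leR_adjI x y : leR (adjI A) (Some x) (Some y) = leR A x y.
Proof.
apply/existsP/existsP => [[[a|] /andP[aA /eqP E]]|[a /andP[aA /eqP->]]].
- exists a; move: aA E; rewrite mem_adjI_Some => ->.
  by case: a => [a|] [->] /=.
- by exists None; case: E => ->; rewrite mem_adjI_None /=.
- by exists (Some a); rewrite mem_adjI_Some aA; case: a {aA} => /=.
Qed.

(** Condition (2) in the definition of [calF], applied to [a], transfers the absence of a strict
    R-descent from [x] to [t]; then [leR_mul_eqII] applies to [t]. *)
Lemma calF_mul_classII x t a : t \in calF A x ->
  a \in KG -> leR A x (x ** a) ->
  exists f, [/\ t = Some f, x ** f = x & f ** a \in classII A f].
Proof.
rewrite inE => /andP[tR /and3P[/eqP xt /forallP/(_ a) h _]] aK xa.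
have aA := group_kernel_sub aK.
have nlt : ~~ ltR A (x ** a) x by rewrite /ltR xa andbF.
move: h; rewrite aA (negbTE nlt) /= eq_sym eqbF_neg negb_and negbK.
have tA : t \in adjI A by move: tR; rewrite inE => /andP[].
have lt_ta : leR (adjI A) (t ** Some a) t.
  by apply/existsP; exists (Some (Some a)); rewrite !mem_adjI_Some aA /=.
(* The adjoined identity is excluded: no right multiple of [Some a] equals [None]. *)
rewrite lt_ta /=; case: t => [f|] in tR xt tA lt_ta *; last first.
  by case/existsP=> -[[b|]|] /andP[_].
rewrite leR_adjI => fa; exists f; split=> //.
rewrite mem_adjI_Some in tA.
by rewrite inE mulA //= leR_mul_eqII.
Qed.

End TypeIIClasses.

(** A relation projecting onto [B] restricts to one projecting onto [A]: keep the pairs whose first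
    component lies in [A]. *)
Lemma group_kernelS (T : finSemigroupType) (A B : {set T}) :
  {in A &, forall y z, y ** z \in A} -> A \subset B ->
  group_kernel A \subset group_kernel B.
Proof.
move=> mA sAB; apply/subsetP=> x; rewrite !inE => /andP[xA /asboolP xK].
rewrite (subsetP sAB) //=; apply/asboolP => gT rho [rB rM].
have /(xK gT) : onto_subsemigroup A [set p in rho | p.1 \in A].
  split=> [|p q]; last first.
    by rewrite !inE => /andP[pr pA] /andP[qr qA] /=; rewrite rM ?mA.
  apply/setP=> y; apply/imsetP/idP=> [[p]|yA].
    by rewrite inE => /andP[_ pA] ->.
  have /imsetP[p pr yp] : y \in [set p.1 | p in rho].
    by rewrite rB (subsetP sAB).
  by exists p; rewrite // inE pr -yp.
by rewrite inE => /andP[].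
Qed.

Lemma classIIS (T : finSemigroupType) (A B : {set T}) x :
  {in A &, forall y z, y ** z \in A} -> A \subset B ->
  classII A x \subset classII B x.
Proof.
move=> mA sAB; have sK := subsetP (group_kernelS mA sAB).
have sKI a : a \in adjI (group_kernel A) -> a \in adjI (group_kernel B).
  by case: a => [a|]; rewrite ?mem_adjI_Some ?mem_adjI_None //; apply: sK.
apply/subsetP=> y; rewrite !inE => /andP[yA].
case/andP=> /existsP[a /andP[aK xy]] /existsP[b /andP[bK yx]].
rewrite (subsetP sAB) //=; apply/andP; split; apply/existsP.
  by exists a; rewrite sKI.
by exists b; rewrite sKI.
Qed.

(** * Closure properties of the complex [CER S] *)

Section ERComplex.
Variable S : finSemigroupType.
Implicit Types (K : {set {set S}}) (X Y : {set S}).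
Local Notation C := (CER S).

Lemma is_complexP K : reflect
  [/\ forall X, X \in K -> X != set0, forall s, [set s] \in K,
      {in K &, forall X Y, X ** Y \in K}
    & forall X Y, X \in K -> Y != set0 -> Y \subset X -> Y \in K]
  (is_complex K).
Proof.
apply: (iffP and4P) => [[/subsetP K0 /forallP K1 /forall_inP KM /forall_inP KS]
                       |[K0 K1 KM KS]].
  split=> // [X /K0|X Y /KM/forall_inP|X Y /KS/forall_inP KX Y0]; rewrite ?inE //.
    by move=> h /h.
  by apply/implyP/KX; rewrite inE.
split; first by apply/subsetP=> X /K0; rewrite inE.
- exact/forallP.
- by apply/forall_inP=> X XK; apply/forall_inP=> Y; apply: KM.
- apply/forall_inP=> X XK; apply/forall_inP=> Y; rewrite inE => Y0.
  by apply/implyP; apply: KS.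
Qed.

Lemma set_smul_neq0 X Y : X != set0 -> Y != set0 -> X ** Y != set0.
Proof.
move=> /set0Pn[x xX] /set0Pn[y yY]; apply/set0Pn; exists (x ** y).
exact: imset2_f.
Qed.

Lemma set_smulS X X' Y Y' : X \subset X' -> Y \subset Y' ->
  X ** Y \subset X' ** Y'.
Proof.
move=> /subsetP sX /subsetP sY; apply/subsetP=> _ /imset2P[x y xX yY ->].
by apply: imset2_f; [apply: sX|apply: sY].
Qed.

Lemma sub_cover_classII K X : X \in K -> X \subset cover (classII K X).
Proof. by move=> XK; apply: (bigcup_sup X); rewrite ?mem_classII. Qed.

(** Taking part in the intersection that defines [CER S], this complex keeps the empty set out of
    it. *)
Lemma nePow_ER_complex : is_ER_complex (nePow S).
Proof.
apply/andP; split.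
  apply/is_complexP; split=> [X|s|X Y|X Y]; rewrite ?inE //.
    by apply/set0Pn; exists s; rewrite inE.
  exact: set_smul_neq0.
apply/forall_inP=> X XK; apply/implyP=> _; rewrite inE.
by apply: subset_neq0 (sub_cover_classII XK) _; rewrite inE in XK.
Qed.

Lemma CER_complex : is_complex C.
Proof.
apply/is_complexP; split=> [X /bigcapP/(_ _ nePow_ER_complex)|s|X Y XC YC|X Y XC Y0 sYX].
- by rewrite inE.
- by apply/bigcapP=> K /andP[/is_complexP[]].
- apply/bigcapP=> K hK; have /andP[/is_complexP[_ _ KM _] _] := hK.
  by apply: KM; [move/bigcapP: XC|move/bigcapP: YC]; apply.
- apply/bigcapP=> K hK; have /andP[/is_complexP[_ _ _ KS] _] := hK.
  by apply: KS sYX => //; move/bigcapP: XC; apply.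
Qed.

Lemma CER_neq0 X : X \in C -> X != set0.
Proof. by have /is_complexP[h _ _ _] := CER_complex; apply: h. Qed.

Lemma CER_set1 s : [set s] \in C.
Proof. by have /is_complexP[_ h _ _] := CER_complex. Qed.

Lemma CER_mul : {in C &, forall X Y, X ** Y \in C}.
Proof. by have /is_complexP[_ _ h _] := CER_complex. Qed.

Lemma CER_sub X Y : X \in C -> Y != set0 -> Y \subset X -> Y \in C.
Proof. by have /is_complexP[_ _ _ h] := CER_complex; apply: h. Qed.

(** For each complex [K] of the intersection, the type-II class of [X] computed in [C] is contained
    in the one computed in [K]. The union of the latter is in [K], which is closed under non-empty
    subsets. *)
Lemma CER_beta X : X \in C -> idem X -> beta X \in C.
Proof.
move=> XC idX; apply/bigcapP=> K hK.
have sCK : C \subset K by apply: bigcap_inf.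
have /andP[/is_complexP[_ _ _ KS] /forall_inP/(_ X)] := hK.
move=> /(_ (subsetP sCK _ XC)) /implyP/(_ idX) bK.
apply: KS bK _ _; first exact: subset_neq0 (sub_cover_classII XC) (CER_neq0 XC).
apply/bigcupsP=> Y YX; apply: (bigcup_sup Y) => //.
exact: (subsetP (classIIS _ CER_mul sCK)).
Qed.

End ERComplex.

(** * The maps [psi] and [bar], and the fixed points of [psi] *)

Section Closure.
Variables (S : finSemigroupType) (E : {set S} -> option {set S}).
Hypothesis hE : idempotent_choice E.
Implicit Types X Y : {set S}.
Local Notation C := (CER S).
Local Notation psi := (psi E).
Local Notation bar := (bar E).
Local Notation FF := (FF E).

Lemma mul_pow1_extensive X Y n : X \subset X ** Y -> X ** Y \subset X ** pow1 Y n.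
Proof.
move=> sXY; elim: n => //= n IHn; rewrite smulA.
by apply: subset_trans IHn _; apply: set_smulS.
Qed.

Lemma psi_None X : E X = None -> psi X = X.
Proof. by move=> EX; rewrite /Defs.psi EX /omega pow1_None. Qed.

(** As X = X F and F lies in its own type-II class, X is contained in X (beta F); multiplying by
    further powers of beta F only enlarges the product. *)
Lemma psi_Some X F : X \in C -> E X = Some F ->
  [/\ psi X \in C, X \subset X ** beta F & X ** beta F \subset psi X].
Proof.
move=> XC EX; have [] := hE XC; rewrite EX inE => /andP[FR /and3P[/eqP XF _ _]].
rewrite /idem => /eqP [/eqP idF] _.
have FC : F \in C by move: FR; rewrite inE mem_adjI_Some => /andP[].
have sX : X \subset X ** beta F.
  by rewrite -{1}XF /= set_smulS // sub_cover_classII.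
rewrite /Defs.psi EX /omega pow1_Some /=; split=> //; last exact: mul_pow1_extensive.
by rewrite CER_mul // pow1_closed ?CER_beta //; apply: CER_mul.
Qed.

Lemma psi_closed X : X \in C -> psi X \in C.
Proof.
move=> XC; case EX: (E X) => [F|]; first by case: (psi_Some XC EX).
by rewrite psi_None.
Qed.

Lemma psi_extensive X : X \in C -> X \subset psi X.
Proof.
move=> XC; case EX: (E X) => [F|]; last by rewrite psi_None.
by have [_ sX /(subset_trans sX)] := psi_Some XC EX.
Qed.

Lemma iter_psi X n : X \in C -> iter n psi X \in C /\ X \subset iter n psi X.
Proof.
move=> XC; elim: n => //= n [IC IX]; rewrite psi_closed //; split=> //.
exact: subset_trans IX (psi_extensive IC).
Qed.

Lemma bar_iter X : exists2 n, bar X = iter n.+1 psi X & bar (bar X) = bar X.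
Proof.
rewrite /Defs.bar; set f := [ffun Y => psi Y].
have /eqP/ffunP/(_ X) := idem_omega f; rewrite ffunE => idf.
have powE n Y : pow1 f n Y = iter n.+1 psi Y.
  elim: n Y => [|n IHn] Y; first by rewrite ffunE.
  by rewrite [LHS]ffunE -/(pow1 f n) IHn ffunE -iterSr.
by eexists; first by rewrite /omega powE.
Qed.

Lemma sub_bar X : X \in C -> X \subset bar X.
Proof. by move=> XC; have [n -> _] := bar_iter X; case: (iter_psi n.+1 XC). Qed.

(** For B = [bar X], the inclusions are B in [psi B] in [bar B] = B. The second one uses that [bar]
    applies [psi] at least once, hence the [n.+1] in [bar_iter]. *)
Lemma bar_FF X : X \in C -> bar X \in FF.
Proof.
move=> XC; have [n Xn XX] := bar_iter X.
have bC : bar X \in C by rewrite Xn; case: (iter_psi n.+1 XC).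
rewrite inE bC eqEsubset psi_extensive // andbT -{2}XX.
have [m -> _] := bar_iter (bar X); rewrite iterSr.
by case: (iter_psi m (psi_closed bC)).
Qed.

Lemma FF_sub X : X \in FF -> X \in C.
Proof. by rewrite inE => /andP[]. Qed.

Lemma cover_classII_FF X : X \in FF -> cover (classII C X) = X.
Proof.
rewrite inE => /andP[XC /eqP psiX]; apply/eqP.
rewrite eqEsubset sub_cover_classII // andbT; apply/bigcupsP=> Y.
rewrite inE => /andP[YC XY]; have /andP[leXY _] := eqII_eqR XY.
have /andP[/existsP[[a|] /andP[aK /eqP /= YE]] _] := XY; last by rewrite -YE.
rewrite mem_adjI_Some in aK; rewrite -YE in leXY *.
have [EX _ _] := hE XC.
have [F [EF XF FaF]] := calF_mul_classII (@CER_mul S) EX aK leXY.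
have [_ _] := psi_Some XC EF; rewrite psiX; apply: subset_trans.
by rewrite -{1}XF -smulA; apply: set_smulS => //; apply: (bigcup_sup (F ** a)).
Qed.

(** * The group action, the values of states and the transitions *)

Section Automaton.
Variable g : S -> {set {set S}} -> {perm {set {set S}}}.
Hypothesis hg : permutation_choice g.
Implicit Types h d : prodG E.
Local Notation GG := (GG E g).

(** The R-class of [X] is a candidate for the choice in [odot], so the default is not reached, and
    by [quoII_Rclass_inj] it is the only candidate. *)
Lemma odotE X Y h : X \in FF -> Y \in Rclass C X ->
  exists R : {R | R \in scrR E},
    val R = Rclass C X /\ odot (classII C Y) h = h R (classII C Y).
Proof.
move=> XF YX; have RX : Rclass C X \in scrR E by apply: imset_f.
rewrite /odot; case: pickP => [R piR|/(_ (exist (fun R => R \in scrR E) _ RX))].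
  exists R; split=> //; have /imsetP[Z _ RZ] := valP R.
  rewrite RZ in piR *; apply: quoII_Rclass_inj piR (imset_f _ YX).
  exact: CER_mul.
by rewrite /= imset_f.
Qed.

Lemma GG_Sym h (R : {R | R \in scrR E}) :
  h \in GG -> h R \in Sym (quoII C (val R)).
Proof.
(* These elements form a subgroup; it suffices that it contains the generators. *)
move=> hG; pose M : {set prodG E} := [set k : prodG E | k R \in Sym (quoII C (val R))].
have gM : group_set M.
  apply/group_setP; split=> [|k l]; first by rewrite in_set ffunE group1.
  by rewrite in_set => kM; rewrite in_set => lM; rewrite in_set ffunE groupM.
suff /subsetP/(_ h hG) : GG \subset Group gM by rewrite in_set.
rewrite gen_subG; apply/subsetP=> _ /imsetP[s _ ->]; rewrite in_set ffunE.
have /imsetP[X XF ->] := valP R.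
by have [] := hg s (imset_f (Rclass C) (FF_sub XF)).
Qed.

(** Membership of [h] in the group keeps the image of the class inside the same R/II, so both
    applications of [odot] on the right use the component at the same [R]. *)
Lemma odot_mul X h k : X \in FF -> h \in GG ->
  odot (classII C X) (h * k) = odot (odot (classII C X) h) k.
Proof.
move=> XF hG; have XX := mem_Rclass (FF_sub XF).
have [R [RX ->]] := odotE (h * k) XF XX; have [R1 [R1X ->]] := odotE h XF XX.
have -> : R1 = R by apply: val_inj; rewrite RX R1X.
have : h R (classII C X) \in quoII C (val R).
  have := GG_Sym R hG; rewrite inE => /perm_closed ->.
  by rewrite RX imset_f.
rewrite RX => /imsetP[Y YX hY]; rewrite hY.
have [R2 [R2X ->]] := odotE k XF YX.
have -> : R2 = R by apply: val_inj; rewrite RX R2X.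
by rewrite -hY ffunE permM.
Qed.

Lemma odot1 (pi : {set {set S}}) : odot pi (1 : prodG E) = pi.
Proof. by rewrite /odot; case: pickP => // R _; rewrite ffunE perm1. Qed.

Lemma gen_GG s : gen E g s \in GG.
Proof. by apply/mem_gen/imset_f. Qed.

Lemma in_QS_diag X h : X \in FF -> h \in GG -> in_QS g X h h.
Proof. by move=> XF hG; rewrite /in_QS XF hG mulVg odot1 imset_f. Qed.

Lemma value_diag X h : X \in FF -> value X h h = X.
Proof. by move=> XF; rewrite /value mulVg odot1 cover_classII_FF. Qed.

Lemma value_FF X d h : in_QS g X d h ->
  value X d h \in FF /\ odot (classII C X) (d^-1 * h) = classII C (value X d h).
Proof.
by case/and4P=> _ _ _ /imsetP[V VF piE]; rewrite /value piE cover_classII_FF.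
Qed.

(** The partial action of s is defined at the class of [V], with [V] itself as representative, and
    the chosen permutation extends it. *)
Lemma odot_gen V s : V \in FF -> eqR C (V ** [set s]) V ->
  odot (classII C V) (gen E g s) = classII C (V ** [set s]).
Proof.
move=> VF VsV; have VC := FF_sub VF; have VV := mem_Rclass VC.
have [R [RV ->]] := odotE (gen E g s) VF VV; rewrite ffunE RV.
have [_] := hg s (imset_f (Rclass C) VC); apply; first exact: imset_f.
exists V; first exact: mem_classII.
by rewrite inE CER_mul ?CER_set1 // eqR_sym.
Qed.

Lemma stepS_QS q s : q \in QS E g -> stepS E g q s \in QS E g :\ iotaS E.
Proof.
case: q => [[[X d] h]|]; rewrite !inE /=; last first.
  by move=> _; apply: in_QS_diag (gen_GG s); apply/bar_FF/CER_set1.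
move=> qQ; have [VF _] := value_FF qQ; have /and4P[_ _ hG _] := qQ.
rewrite /lambda; case: ifP => [/andP[_] //|_].
by apply: in_QS_diag; rewrite ?groupM ?gen_GG // bar_FF ?CER_mul ?CER_set1 ?FF_sub.
Qed.

Lemma stepS_flow X d h s : in_QS g X d h ->
  value X d h ** [set s] \subset PhiS E (stepS E g (Some (X, d, h)) s).
Proof.
move=> qQ; have [VF VE] := value_FF qQ; have /and4P[XF dG hG _] := qQ.
have VsC : value X d h ** [set s] \in C by rewrite CER_mul ?CER_set1 ?FF_sub.
rewrite /stepS /lambda; case: ifP => [/andP[VsV _]|_] /=; last first.
  (* The new state has equal group components, so its value is [bar] of the product. *)
  by rewrite value_diag ?bar_FF ?sub_bar.
(* With V the old value, reassociating d^-1 (h g_s) shows that g_s acts on the class of V, giving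
   the class of V s. *)
rewrite {2}/value mulgA odot_mul ?groupM ?groupV // VE odot_gen //.
exact: sub_cover_classII.
Qed.

End Automaton.
End Closure.

Theorem proposition7p12 (S : finSemigroupType)
    (E : {set S} -> option {set S})
    (g : S -> {set {set S}} -> {perm {set {set S}}})
    (hE : idempotent_choice E) (hg : permutation_choice g) :
  [/\ is_flow (QS E g) (iotaS E) (stepS E g) (PhiS E),
      is_flow_automaton (QS E g) (iotaS E) (stepS E g) (PhiS E)
    & Cov (QS E g) (iotaS E) (PhiS E) \subset CER S].
Proof.
have PhiC q : q \in QS E g :\ iotaS E -> PhiS E q \in CER S.
  case: q => [[[X d] h]|]; rewrite !inE //= => qQ.
  by apply: (@FF_sub _ E); have [] := value_FF hE qQ.
have flow : is_flow (QS E g) (iotaS E) (stepS E g) (PhiS E).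
  split=> [q /PhiC/CER_neq0||s|[[[X d] h]|] s]; rewrite ?inE //.
  - by move=> q s; apply: stepS_QS.
  - rewrite /= value_diag ?bar_FF ?CER_set1 //.
    by apply: (subsetP (sub_bar hE (CER_set1 s))); rewrite inE.
  - exact: stepS_flow.
split=> //; first split=> //; first split=> [|q s qQ].
- by rewrite inE.
- by have := stepS_QS hE s qQ; rewrite inE => /andP[].
(* Values of states lie in [CER S], which is closed under non-empty subsets. *)
apply/subsetP=> X; rewrite !inE => /andP[X0 /existsP[q /andP[qQ sX]]].
by apply: CER_sub (PhiC q qQ) X0 sX.
Qed.
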